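(* Let $G$ be the configuration space Lie group of a rigid body (a finite-dimensional real matrix Lie group, for instance $SE(3)$ or $SO(3)\times\mathbb{R}^3$) with Lie algebra $\mathfrak{g}$. Suppose that the motion of the body is constrained to a subgroup of $G$: there is a Lie subgroup $H\subseteq G$ with Lie algebra $\mathfrak{h}\subseteq\mathfrak{g}$ such that a configuration $g\in G$ satisfies the kinematic motion constraints of the body if and only if $g\in H$. Consider a configuration update step (from $t_{i-1}$ to $t_i$) in terms of linear combinations of velocity samples $V^{(1)},\dots,V^{(s)}$, where the previous configuration satisfies the motion constraints and the velocity samples satisfy the corresponding velocity constraints, i.e. $V^{(j)}\in\mathfrak{h}$ for all $j$. Then the updated configuration satisfies the motion constraints of the body, i.e. $g(t_i)\in H$.
   Context: A configuration of a rigid body is represented by an element of its configuration space (c-space) Lie group $G$. The group $SE(3)=SO(3)\ltimes\mathbb{R}^3$ has multiplication $(R_1,r_1)(R_2,r_2)=(R_1R_2,\,r_1+R_1r_2)$; the direct product $SO(3)\times\mathbb{R}^3$ has multiplication $(R_1,r_1)(R_2,r_2)=(R_1R_2,\,r_1+r_2)$. The velocity of a motion $g(t)\in G$ is the left-invariant velocity $V=g^{-1}\dot g\in\mathfrak{g}$. For $X,Y\in\mathfrak{g}$, $\mathrm{ad}_X Y=[X,Y]$, and $\exp:\mathfrak{g}\to G$ is the exponential map. A configuration update step in terms of linear combinations of velocity samples is the following. Given finitely many velocity samples $V^{(1)},\dots,V^{(s)}\in\mathfrak{g}$ (the velocities of the body at the intermediate stages $t_{i-1}+c_j\Delta t$ of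 a numerical integration scheme), one forms an element $\Phi^{(i)}\in\mathfrak{g}$ that is a (finite, or convergent infinite) real linear combination of the samples and of nested Lie brackets of the samples, such as $\mathrm{ad}_{V^{(j)}}^{r}V^{(k)}$ with $r\ge 0$, with coefficients specific to the integration scheme. The new configuration is then either $g(t_i)=g(t_{i-1})\exp\Phi^{(i)}$ (Lie group integrator), or $g(t_i)=\exp q^{(i)}$ with $q^{(i)}=q^{(i-1)}+\Phi^{(i)}$ (integration in canonical coordinates). The previous configuration satisfying the motion constraints means $g(t_{i-1})\in H$ in the first case, and $q^{(i-1)}\in\mathfrak{h}$ (so that $g(t_{i-1})=\exp q^{(i-1)}\in H$) in the second case. *)

(* Defs.v *)
From HB Require Import structures.
From mathcomp Require Import all_boot all_order all_algebra.
From mathcomp Require Import all_classical all_reals all_analysis.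

Set Implicit Arguments.
Unset Strict Implicit.
Unset Printing Implicit Defensive.

Import Order.TTheory GRing.Theory Num.Theory.
Import numFieldNormedType.Exports.

Local Open Scope classical_set_scope.
Local Open Scope ring_scope.

Fixpoint Ck (R : realType) (V W : normedModType R) (k : nat) (U : set V)
    (f : V -> W) : Prop :=
  match k with
  | 0 => forall x, U x -> {for x, continuous f}
  | k'.+1 => (forall x, U x -> differentiable f x) /\
             (forall v, Ck k' U (fun x => 'd f x v))
  end.

(* Only used on open sets [U]; [f] is unconstrained outside [U]. *)
Definition smooth_on (R : realType) (V W : normedModType R) (U : set V)
    (f : V -> W) : Prop := forall k, Ck k U f.

(* A chart is given by the inverse of a coordinate map: a parametrization
   [chart_map : chart_dom -> 'M_n], with [chart_map] junk outside [chart_dom]. *)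
Record chart (R : realType) (n d : nat) := Chart {
  chart_dom : set 'rV[R]_d ;
  chart_map : 'rV[R]_d -> 'M[R]_n }.

Definition immersed_chart (R : realType) (n d : nat) (c : chart R n d) : Prop :=
  [/\ open (chart_dom c),
      {in chart_dom c &, injective (chart_map c)},
      smooth_on (chart_dom c) (chart_map c) &
      forall u, chart_dom c u -> injective ('d (chart_map c) u)].

(* [F : D -> 'M_n], read in the chart [c], has open domain of definition and is
   smooth there: [f] is the local representative [c^-1 \o F]. *)
Definition smooth_into_chart (R : realType) (n d : nat) (V : normedModType R)
    (D : set V) (F : V -> 'M[R]_n) (c : chart R n d) : Prop :=
  let W := [set x | D x /\ (chart_map c @` chart_dom c) (F x)] in
  open W /\
  exists2 f : V -> 'rV[R]_d, smooth_on W f &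
    forall x, W x -> chart_dom c (f x) /\ chart_map c (f x) = F x.

(* A real matrix Lie group: a subgroup of GL_n(R) with a d-dimensional,
   second countable manifold structure for which the group operations are
   smooth and the inclusion into 'M_n is an immersion.  The manifold topology
   is the one generated by the charts; it need not be the subspace topology, so
   that non-closed (immersed) groups are covered.  It is Hausdorff because the
   inclusion into 'M_n is continuous. *)
Record matrix_lie_group (R : realType) (n : nat) := MatrixLieGroup {
  mlg_set : set 'M[R]_n ;
  mlg_dim : nat ;
  mlg_atlas : set (chart R n mlg_dim) ;
  mlg_unit : mlg_set `<=` [set g | g \in unitmx] ;
  mlg_1 : mlg_set 1%:M ;
  mlg_M : forall g h, mlg_set g -> mlg_set h -> mlg_set (g *m h) ;
  mlg_V : forall g, mlg_set g -> mlg_set (invmx g) ;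
  mlg_countable : countable mlg_atlas ;
  mlg_immersed : forall c, mlg_atlas c -> immersed_chart c ;
  mlg_cover :
    mlg_set = \bigcup_(c in mlg_atlas) (chart_map c @` chart_dom c) ;
  mlg_transition : forall a b, mlg_atlas a -> mlg_atlas b ->
    smooth_into_chart (chart_dom a) (chart_map a) b ;
  mlg_smoothM : forall a b c, mlg_atlas a -> mlg_atlas b -> mlg_atlas c ->
    smooth_into_chart (chart_dom a `*` chart_dom b)
      (fun uv => chart_map a uv.1 *m chart_map b uv.2) c ;
  mlg_smoothV : forall a b, mlg_atlas a -> mlg_atlas b ->
    smooth_into_chart (chart_dom a) (fun u => invmx (chart_map a u)) b }.

(* The inclusion H -> G is smooth; it is then an immersion because the
   inclusion H -> 'M_n is one and factors through it. *)
Definition lie_subgroup (R : realType) (n : nat) (H G : matrix_lie_group R n) :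
    Prop :=
  mlg_set H `<=` mlg_set G /\
  forall a b, mlg_atlas (m := H) a -> mlg_atlas (m := G) b ->
    smooth_into_chart (chart_dom a) (chart_map a) b.

(* The tangent space at the identity, as a subspace of 'M_n. *)
Definition lie_algebra (R : realType) (n : nat) (G : matrix_lie_group R n) :
    set 'M[R]_n :=
  [set X | exists c u v, [/\ mlg_atlas (m := G) c, chart_dom c u,
     chart_map c u = 1%:M & X = 'd (chart_map c) u v]].

Definition expmx (R : realType) (n : nat) (X : 'M[R]_n) : 'M[R]_n :=
  limn (series (fun k => k`!%:R^-1 *: X ^+ k)).

Definition lie_bracket (R : realType) (n : nat) (X Y : 'M[R]_n) : 'M[R]_n :=
  X *m Y - Y *m X.

(* All nested brackets of samples, arbitrarily bracketed; in particular
   [ad_(V j)^r (V k)] for every r >= 0. *)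
Inductive nested_bracket (R : realType) (n s : nat) (V : 'I_s -> 'M[R]_n) :
    'M[R]_n -> Prop :=
  | nested_sample j : nested_bracket V (V j)
  | nested_lie X Y : nested_bracket V X -> nested_bracket V Y ->
      nested_bracket V (lie_bracket X Y).

Definition finite_combination (R : realType) (n s : nat) (V : 'I_s -> 'M[R]_n)
    (Phi : 'M[R]_n) : Prop :=
  exists (m : nat) (a : 'I_m -> R) (B : 'I_m -> 'M[R]_n),
    (forall k, nested_bracket V (B k)) /\ Phi = \sum_k a k *: B k.

Definition infinite_combination (R : realType) (n s : nat)
    (V : 'I_s -> 'M[R]_n) (Phi : 'M[R]_n) : Prop :=
  exists (a : nat -> R) (B : nat -> 'M[R]_n),
    (forall k, nested_bracket V (B k)) /\
    series (fun k => a k *: B k) @ \oo --> Phi.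

Definition sample_combination (R : realType) (n s : nat) (V : 'I_s -> 'M[R]_n)
    (Phi : 'M[R]_n) : Prop :=
  finite_combination V Phi \/ infinite_combination V Phi.

(* Lie group integrator: from the configuration [g0] to [g1]. *)
Definition group_step (R : realType) (n s : nat) (V : 'I_s -> 'M[R]_n)
    (g0 g1 : 'M[R]_n) : Prop :=
  exists2 Phi, sample_combination V Phi & g1 = g0 *m expmx Phi.

(* Integration in canonical coordinates: from the coordinates [q0] to the
   configuration [g1]. *)
Definition coordinate_step (R : realType) (n s : nat) (V : 'I_s -> 'M[R]_n)
    (q0 g1 : 'M[R]_n) : Prop :=
  exists2 Phi, sample_combination V Phi & g1 = expmx (q0 + Phi).

(* Main.v *)
Require Import Defs.
From mathcomp Require Import all_boot all_order all_algebra.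
From mathcomp Require Import all_classical all_reals all_analysis.
From mathcomp Require Import lra.

(** Let [h] be the Lie algebra of [H].  The updated configuration is [g0 exp Phi]
    with [g0] in [H], or [exp (q0 + Phi)] with [q0] in [h], where [Phi] is a
    finite sum or a limit of combinations of brackets of elements of [h].  So
    everything rests on four facts about an immersed matrix Lie group: [h] is a
    linear subspace, it is topologically closed, it is stable under brackets,
    and the exponential maps it into the group.

    All four are obtained in charts from first-order information only.  The
    carrier of the calculus is [chart_mul]: since multiplication is smooth, a
    product of two differentiable families of elements of [H] can be read in any
    chart as a differentiable family.  Multiplying by the constant [1] moves a
    tangent vector at the identity from one chart to another, so [h] is the
    range of the differential of any chart at the identity
    ([lie_algebraE]); it is therefore a subspace, and a closed one because an
    injective linear map in finite dimension has a continuous left inverse.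
    Multiplying on both sides by constants shows that [h] is stable under
    conjugation by [H] ([lie_algebra_conj]).  For [X] and [Y] in [h], with [g] a
    curve in [H] through [1] of velocity [X], the difference quotients of
    [g(t) Y g(t)^-1] stay in [h] and tend to [X Y - Y X]; closedness gives
    [lie_algebra_bracket].

    For the exponential, no differential equation is solved.  If [X] is the
    velocity at [u] of the curve [t |-> c(u + t v)] of a chart [c] with
    [c(u) = 1], then [c(u + v/N)^N] tends to [expmx X].  When [X] is small, the
    matrices [c(u + v/N)^j], [j <= N], all stay close to [1].  An immersion
    expands distances near [u] up to a constant ([diff_expanding]), which keeps
    their coordinates in a fixed compact ball of the chart, so that the
    matrices lie in the compact image of this ball and so does their limit
    ([expmx_small]).  Working with coordinates is essential here: [H] need not
    be closed in the matrices, and elements of [H] may converge to a matrix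
    outside [H].  The general case follows from
    [expmx X = expmx (X/M)^M] ([expmx_natV]). *)

Set Implicit Arguments.
Unset Strict Implicit.
Unset Printing Implicit Defensive.

Import Order.TTheory GRing.Theory Num.Theory.
Import numFieldNormedType.Exports.
Local Open Scope classical_set_scope.
Local Open Scope ring_scope.

(** * The maximum norm and matrix products *)

Section MatrixNorm.
Variables (R : realType) (n : nat).
Implicit Types X Y : 'M[R]_n.

Lemma ler_mx_entry m p (A : 'M[R]_(m, p)) i j : `|A i j| <= `|A|.
Proof.
rewrite [leRHS]/Num.Def.normr /= mx_normrE; apply/bigmax_geP; right => /=.
by exists (i, j).
Qed.

Lemma ler_mx_norm m p (A : 'M[R]_(m, p)) e : 0 <= e ->
  (forall i j, `|A i j| <= e) -> `|A| <= e.
Proof. by move=> e0 Ae; rewrite /Num.Def.normr /= mx_normrE bigmax_le. Qed.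

(** The factor [p] is the price of the maximum norm, which is not
    submultiplicative; it is why [n%:R * `|X|] plays the role of the size of [X]
    throughout. *)
Lemma mx_norm_mulmx m p q (A : 'M[R]_(m, p)) (B : 'M[R]_(p, q)) :
  `|A *m B| <= p%:R * `|A| * `|B|.
Proof.
apply: ler_mx_norm => [|i j]; first by rewrite !mulr_ge0.
rewrite mxE (le_trans (ler_norm_sum _ _ _))//.
rewrite -mulrA mulr_natl -[leRHS](_ : \sum_(k < p) `|A| * `|B| = _).
  by apply: ler_sum => k _; rewrite normrM ler_pM ?ler_mx_entry.
by rewrite sumr_const card_ord.
Qed.

Lemma cvg_mulmx T (F : set_system T) {FF : Filter F} m p q
    (f : T -> 'M[R]_(m, p)) (g : T -> 'M[R]_(p, q))
    (A : 'M[R]_(m, p)) (B : 'M[R]_(p, q)) :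
  f @ F --> A -> g @ F --> B -> (fun x => f x *m g x) @ F --> A *m B.
Proof.
move=> fA gB; apply/subr_cvg0/norm_cvg0P.
apply: (@squeeze_cvgr _ _ _ _ (fun=> 0) (fun x =>
  p%:R * `|f x - A| * `|g x| + p%:R * `|A| * `|g x - B|)); last 2 first.
- exact: cvg_cst.
- have /norm_cvg0P fA0 : (fun x => f x - A) @ F --> (0 : 'M[R]_(m, p)).
    by apply/subr_cvg0.
  have /norm_cvg0P gB0 : (fun x => g x - B) @ F --> (0 : 'M[R]_(p, q)).
    by apply/subr_cvg0.
  rewrite -[X in _ --> X](_ : p%:R * 0 * `|B| + p%:R * `|A| * 0 = 0); last first.
    by rewrite !(mulr0, mul0r) addr0.
  apply: cvgD; last by apply: cvgM => //; exact: cvg_cst.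
  by apply: cvgM; [apply: cvgM => //; exact: cvg_cst|exact: cvg_norm].
apply: nearW => x; rewrite normr_ge0 /=.
have -> : f x *m g x - A *m B = (f x - A) *m g x + A *m (g x - B).
  by rewrite mulmxBl mulmxBr addrA subrK.
by rewrite (le_trans (ler_normD _ _))// lerD// mx_norm_mulmx.
Qed.

Lemma cvg_mx_exprn T (F : set_system T) {FF : Filter F} (f : T -> 'M[R]_n) X k :
  f @ F --> X -> (fun x => f x ^+ k) @ F --> X ^+ k.
Proof.
move=> fX; elim: k => [|k IH]; first exact: cvg_cst.
under eq_fun do rewrite exprS; rewrite exprS.
exact: cvg_mulmx.
Qed.

Lemma mx_norm1 : `|1 : 'M[R]_n| <= 1.
Proof.
by apply: ler_mx_norm => // i j; rewrite mxE; case: eqP; rewrite ?normr1 ?normr0.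
Qed.

Lemma mx_norm_exp X k : `|X ^+ k| <= (n%:R * `|X|) ^+ k.
Proof.
elim: k => [|k IH]; first by rewrite !expr0 mx_norm1.
rewrite !exprS (le_trans (mx_norm_mulmx _ _))// ler_wpM2l// mulr_ge0//.
Qed.

(** Estimating powers of [1 + Y] rather than of an arbitrary matrix avoids
    rescaling the norm by [n], after which [1] would have norm [n] and the
    [N]-th powers of matrices [1 + O(1/N)] would not stay bounded. *)
Lemma mx_norm_exp1D Y k : `|(1 + Y) ^+ k| <= (1 + n%:R * `|Y|) ^+ k.
Proof.
elim: k => [|k IH]; first by rewrite !expr0 mx_norm1.
rewrite !exprS mulrDl mul1r (le_trans (ler_normD _ _))//.
rewrite mulrDl mul1r lerD// (le_trans (mx_norm_mulmx _ _))//.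
by rewrite ler_wpM2l// mulr_ge0.
Qed.

Lemma mx_norm_exp1DB1 Y k :
  `|(1 + Y) ^+ k - 1| <= (1 + n%:R * `|Y|) ^+ k - 1.
Proof.
elim: k => [|k IH]; first by rewrite !expr0 !subrr normr0.
rewrite !exprS !mulrDl !mul1r ![_ + _ - 1]addrAC.
rewrite (le_trans (ler_normD _ _))// lerD// (le_trans (mx_norm_mulmx _ _))//.
by rewrite ler_wpM2l ?mulr_ge0// mx_norm_exp1D.
Qed.

(** One-step errors accumulate linearly: passing from the [k]-th to the
    [k.+1]-st power amplifies the error by [1 + n r] and adds one new
    difference [Y - X]. *)
Lemma mx_norm_exp1DB X Y r k : `|X| <= r -> `|Y| <= r ->
  `|(1 + Y) ^+ k - (1 + X) ^+ k|
    <= k%:R * (n%:R * `|Y - X|) * (1 + n%:R * r) ^+ k.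
Proof.
move=> Xr Yr; have r0 : 0 <= r by apply: le_trans Xr.
elim: k => [|k IH]; first by rewrite !expr0 subrr normr0 mulr1 mul0r.
have -> : (1 + Y) ^+ k.+1 - (1 + X) ^+ k.+1 =
  ((1 + Y) ^+ k - (1 + X) ^+ k) + (Y * ((1 + Y) ^+ k - (1 + X) ^+ k) +
  (Y - X) * (1 + X) ^+ k).
  rewrite !exprS mulrBr mulrBl !mulrDl !mul1r.
  by rewrite subrKA opprD addrACA.
set D := _ - _ in IH *; set q := (1 + _ * r).
have q1 : 1 <= q by rewrite lerDl mulr_ge0.
rewrite (le_trans (ler_normD _ _))//.
have h1 : `|Y * D| <= (n%:R * r) * `|D|.
  by rewrite (le_trans (mx_norm_mulmx _ _))// ler_wpM2r// ler_wpM2l.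
have h2 : `|(Y - X) * (1 + X) ^+ k| <= n%:R * `|Y - X| * q ^+ k.+1.
  rewrite (le_trans (mx_norm_mulmx _ _))// ler_wpM2l ?mulr_ge0//.
  rewrite (le_trans (mx_norm_exp1D _ _))//.
  have : (1 + n%:R * `|X|) ^+ k <= q ^+ k.
    by rewrite lerXn2r ?nnegrE ?addr_ge0 ?mulr_ge0// lerD2l ler_wpM2l.
  by move=> /le_trans -> //; rewrite ler_weXn2l.
have h3 := le_trans (ler_normD _ _) (lerD h1 h2).
rewrite (le_trans (lerD (lexx _) h3))//.
rewrite addrA -{1}[`|D|]mul1r -mulrDl -/q.
have : q * `|D| <= q * (k%:R * (n%:R * `|Y - X|) * q ^+ k).
  by rewrite ler_wpM2l// (le_trans _ q1).
rewrite mulrCA -exprS => h4.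
by rewrite (le_trans (lerD h4 (lexx _)))// -addn1 natrD !mulrDl mul1r.
Qed.

End MatrixNorm.

(** * The exponential as a limit of powers *)

Section ExponentialLimit.
Variable R : realType.

Lemma cvg_inv_nat : (N%:R^-1 : R) @[N --> \oo] --> 0.
Proof. by rewrite -cvg_shiftS; exact: cvg_harmonic. Qed.

Lemma compound_le_expR (x : R) N : 0 <= x -> (1 + N%:R^-1 * x) ^+ N <= expR x.
Proof.
case: N => [|N] x0; first by rewrite expr0 -expR0 ler_expR.
rewrite -[X in expR X](@mulVKf _ N.+1%:R)// expRM_natl.
rewrite lerXn2r ?nnegrE ?expR_ge0 ?addr_ge0 ?mulr_ge0//.
by rewrite expR_ge1Dx.
Qed.

(** Squeezed between [expR (x / (1 + x/N))] and [expR x]: both bounds come from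
    [1 + t <= expR t], at [t = y] and at [t = - y / (1 + y)] for [y = x/N]. *)
Lemma cvg_compound_expR (x : R) : 0 <= x ->
  (1 + N%:R^-1 * x) ^+ N @[N --> \oo] --> expR x.
Proof.
move=> x0.
apply: (@squeeze_cvgr _ _ _ _ (fun N : nat => expR (x / (1 + N%:R^-1 * x)))
  (fun=> expR x)); last 2 first.
- apply: continuous_cvg; first exact: continuous_expR.
  rewrite -[X in _ --> X]divr1; apply: cvgM; first exact: cvg_cst.
  apply: cvgV => //; rewrite -[X in _ --> X]addr0.
  apply: cvgD; first exact: cvg_cst.
  by rewrite -[X in _ --> X](mul0r x); apply: cvgMl; exact: cvg_inv_nat.
- exact: cvg_cst.
near=> N; rewrite compound_le_expR// andbT.
have N0 : (0 < N)%N by near: N; exact: nbhs_infty_gt.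
have N0' : N%:R != 0 :> R by rewrite pnatr_eq0 -lt0n.
set y := N%:R^-1 * x; have y0 : 0 <= y by rewrite mulr_ge0.
have -> : x / (1 + y) = N%:R * (y / (1 + y)) by rewrite mulrA mulVKf.
rewrite expRM_natl lerXn2r ?nnegrE ?expR_ge0 ?addr_ge0//.
have y1 : 0 < 1 + y by lra.
rewrite -[leRHS]invrK -[leLHS]invrK lef_pV2 ?posrE ?invr_gt0 ?expR_gt0//.
rewrite -expRN (le_trans _ (expR_ge1Dx _))//.
by rewrite -{2}(@divff _ (1 + y)) ?gt_eqF// -mulNr -mulrDl addrK mul1r.
Unshelve. all: by end_near. Qed.

Lemma ffact_leq_exp N k : (N ^_ k <= N ^ k)%N.
Proof.
by elim: k => // k IH; rewrite ffactnSr expnSr leq_mul// leq_subr.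
Qed.

(** The coefficients of [(1 + X/N)^N] are dominated by those of the exponential
    series, which is what reduces the matrix limit to the scalar one. *)
Lemma bin_coef_le (N k : nat) : N%:R^-1 ^+ k *+ 'C(N, k) <= k`!%:R^-1 :> R.
Proof.
case: N => [|N].
  case: k => [|k]; first by rewrite expr0 bin0 fact0 invr1.
  by rewrite bin0n mulr0n invr_ge0.
rewrite -mulr_natr mulrC -[leRHS]mul1r ler_pdivlMr ?ltr0n ?fact_gt0//.
rewrite mulrAC -natrM bin_ffact exprVn ler_pdivrMr ?exprn_gt0//.
by rewrite mul1r -natrX ler_nat ffact_leq_exp.
Qed.

Variable n : nat.
Implicit Types X Y : 'M[R]_n.

Lemma exprZmx (a : R) X k : (a *: X) ^+ k = a ^+ k *: X ^+ k.
Proof.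
elim: k => [|k IH]; first by rewrite !expr0 scale1r.
by rewrite !exprS IH -[LHS]scalemxAl -scalemxAr scalerA.
Qed.

Lemma mx_compound_binomial X N :
  (1 + N%:R^-1 *: X) ^+ N =
  \sum_(i < N.+1) (N%:R^-1 ^+ i *+ 'C(N, i)) *: X ^+ i.
Proof.
by rewrite addrC exprD1n; apply: eq_bigr => i _; rewrite exprZmx scalerMnl.
Qed.

Lemma cvg_series_expmx X :
  series (fun k => k`!%:R^-1 *: X ^+ k) @ \oo --> expmx X.
Proof.
apply/cauchy_cvgP/cauchy_seriesP => e e0.
have /cauchy_cvgP/cauchy_seriesP/(_ _ e0) :=
  is_cvg_series_exp_coeff (n%:R * `|X|).
apply: filterS => -[a b] /=; apply: le_lt_trans.
rewrite (le_trans (ler_norm_sum _ _ _))//.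
rewrite [leRHS]ger0_norm; last first.
  by apply: sumr_ge0 => i _; rewrite exp_coeff_ge0// mulr_ge0.
apply: ler_sum => i _.
by rewrite normrZ ger0_norm ?invr_ge0// mulrC ler_wpM2r ?invr_ge0// mx_norm_exp.
Qed.

(** The difference between the [N]-th partial sum of the exponential series and
    [(1 + X/N)^N] is a combination of powers of [X] with nonnegative
    coefficients, so its norm is at most the same difference for the scalar
    [n%:R * `|X|]; and the latter tends to [expR x - expR x = 0]. *)
Lemma cvg_compound_expmx X : (1 + N%:R^-1 *: X) ^+ N @[N --> \oo] --> expmx X.
Proof.
set x := n%:R * `|X|; have x0 : 0 <= x by rewrite mulr_ge0.
(* [(1 + X/N)^N] has [N.+1] terms, hence the shift of the partial sums. *)
have := @cvg_series_expmx X; rewrite -cvg_shiftS => cS.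
have cs : series (exp_coeff x) N.+1 - (1 + N%:R^-1 * x) ^+ N @[N --> \oo] --> 0.
  rewrite -(subrr (expR x)); apply: cvgB; last exact: cvg_compound_expR.
  by rewrite (cvg_shiftS (series (exp_coeff x))); exact: is_cvg_series_exp_coeff.
rewrite -[X in _ --> X]subr0.
rewrite [X in X @ _](_ : _ = fun N => series (fun k => k`!%:R^-1 *: X ^+ k) N.+1
  - (series (fun k => k`!%:R^-1 *: X ^+ k) N.+1 - (1 + N%:R^-1 *: X) ^+ N));
  last by apply/funext => N; rewrite subKr.
apply: cvgB cS _; apply/norm_cvg0P.
apply: (@squeeze_cvgr _ _ _ _ (fun=> 0) (fun N =>
  series (exp_coeff x) N.+1 - (1 + N%:R^-1 * x) ^+ N)); last 2 first.
- exact: cvg_cst.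
- exact: cs.
near=> N; rewrite normr_ge0 /=.
rewrite mx_compound_binomial [1 + _]addrC exprD1n /series/= !big_mkord -!sumrB.
rewrite (le_trans (ler_norm_sum _ _ _))//; apply: ler_sum => i _.
rewrite -scalerBl normrZ ger0_norm ?subr_ge0 ?bin_coef_le//.
rewrite exprMn -mulrnAl /exp_coeff /= [x ^+ i / _]mulrC -mulrBl.
by rewrite ler_wpM2l ?mx_norm_exp// subr_ge0 bin_coef_le.
Unshelve. all: by end_near. Qed.

(** The form needed for curves: [Y_ N] will be a difference quotient, known
    only to converge to the velocity. *)
Lemma cvg_compound_expmx_seq (Y_ : nat -> 'M[R]_n) X : Y_ @ \oo --> X ->
  (1 + N%:R^-1 *: Y_ N) ^+ N @[N --> \oo] --> expmx X.
Proof.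
move=> YX; set r := `|X| + 1.
have Xr : `|X| <= r by rewrite lerDl.
rewrite -[X in _ --> X]addr0.
rewrite [X in X @ _](_ : _ = fun N => (1 + N%:R^-1 *: X) ^+ N +
  ((1 + N%:R^-1 *: Y_ N) ^+ N - (1 + N%:R^-1 *: X) ^+ N)); last first.
  by apply/funext => N; rewrite [RHS]addrC subrK.
apply: cvgD; first exact: cvg_compound_expmx.
apply/norm_cvg0P.
apply: (@squeeze_cvgr _ _ _ _ (fun=> 0)
  (fun N => n%:R * `|Y_ N - X| * expR (n%:R * r))); last 2 first.
- exact: cvg_cst.
- rewrite -[X in _ --> X](mul0r (expR (n%:R * r))); apply: cvgMl.
  rewrite -[X in _ --> X](mulr0 (n%:R : R)); apply: cvgMr.
  by apply/norm_cvg0P; apply/subr_cvg0.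
near=> N; rewrite normr_ge0 /=.
have N0 : (0 < N)%N by near: N; exact: nbhs_infty_gt.
have N0' : N%:R != 0 :> R by rewrite pnatr_eq0 -lt0n.
have Yr : `|Y_ N| <= r.
  rewrite -(subrK X (Y_ N)) (le_trans (ler_normD _ _))// addrC lerD2l.
  by rewrite ltW// distrC; near: N; apply: cvgr_dist_lt.
have nZ (Z : 'M[R]_n) : `|Z| <= r -> `|N%:R^-1 *: Z| <= N%:R^-1 * r.
  by move=> Zr; rewrite normrZ ger0_norm ?invr_ge0// ler_wpM2l ?invr_ge0.
rewrite (le_trans (mx_norm_exp1DB _ (nZ _ Xr) (nZ _ Yr)))//.
rewrite -scalerBr normrZ ger0_norm ?invr_ge0//.
rewrite [n%:R * (_ * _)]mulrCA mulVKf//.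
rewrite ler_wpM2l ?mulr_ge0// mulrCA compound_le_expR// mulr_ge0//.
by rewrite addr_ge0.
Unshelve. all: by end_near. Qed.

(** Both sides are limits of [(1 + X/(N M))^(N M)], the left one along a
    subsequence; this dispenses with multiplying exponential series. *)
Lemma expmx_natV X M : (0 < M)%N -> expmx X = expmx (M%:R^-1 *: X) ^+ M.
Proof.
move=> M0.
have h1 : (1 + (N * M)%N%:R^-1 *: X) ^+ (N * M)%N @[N --> \oo] --> expmx X.
  exact: (cvg_comp _ _ (cvg_mulnr M M0) (@cvg_compound_expmx X)).
have h2 : (1 + N%:R^-1 *: (M%:R^-1 *: X)) ^+ N ^+ M @[N --> \oo] -->
    expmx (M%:R^-1 *: X) ^+ M by apply: cvg_mx_exprn; exact: cvg_compound_expmx.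
rewrite (_ : (fun _ => _) =
  fun N => (1 + N%:R^-1 *: (M%:R^-1 *: X)) ^+ N ^+ M) in h1; last first.
  by apply/funext => N; rewrite scalerA natrM invfM exprM.
exact: (cvg_unique (@norm_hausdorff _ _) h1 h2).
Qed.

End ExponentialLimit.

(** * Differentiable maps into matrices *)

Section DifferentialCalculus.
Variable R : realType.

Lemma mx_linear_continuous m p (W : normedModType R)
  (f : {linear 'M[R]_(m, p) -> W}) : continuous f.
Proof.
apply/linear_bounded_continuous/linear_boundedP.
near=> r => X.
rewrite {1}[X]matrix_sum_delta linear_sum (le_trans (ler_norm_sum _ _ _))//.
apply: (@le_trans _ _
    ((\sum_(i < m) \sum_(j < p) `|f (delta_mx i j)|) * `|X|)); last first.
  by rewrite ler_wpM2r//; near: r; exact: nbhs_pinfty_ge.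
rewrite mulr_suml; apply: ler_sum => i _.
rewrite linear_sum (le_trans (ler_norm_sum _ _ _))// mulr_suml.
apply: ler_sum => j _.
by rewrite linearZ normrZ mulrC ler_wpM2l// ler_mx_entry.
Unshelve. all: by end_near. Qed.

(** Read on vectors, [f] is right multiplication by a matrix [A] of full row
    rank, and [pinvmx A] inverts it on its range. *)
Lemma linear_left_inverse d m p (f : {linear 'rV[R]_d -> 'M[R]_(m, p)}) :
  injective f -> exists L : {linear 'M[R]_(m, p) -> 'rV[R]_d}, cancel f L.
Proof.
move=> finj.
pose A := lin1_mx (mxvec \o f).
exists (mulmxr (pinvmx A) \o mxvec) => v /=.
have fA w : w *m A = mxvec (f w) by rewrite mul_rV_lin1.
rewrite -fA mulmxKp//; apply: inj_row_free => w; rewrite fA => /eqP.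
rewrite mxvec_eq0 => /eqP fw0; apply: finj.
by rewrite fw0 linear0.
Qed.

Lemma closed_linear_range d m p (f : {linear 'rV[R]_d -> 'M[R]_(m, p)}) :
  injective f -> closed (range f).
Proof.
move=> /linear_left_inverse[L fK].
have -> : range f = (fun X => f (L X) - X) @^-1` [set 0].
  apply/seteqP; split => [_ [v _ <-]|X /= /eqP]; first by rewrite /= fK subrr.
  by rewrite subr_eq0 => /eqP <-; exists (L X).
apply: preimage_closed; last first.
  by apply/accessible_closed_set1/hausdorff_accessible/norm_hausdorff.
move=> X _; apply: (@cvgB _ _ _ (nbhs X)); last exact: cvg_id.
apply: (@continuous_comp _ _ _ L f); exact: mx_linear_continuous.
Qed.

(** Apply a left inverse of the differential to the first-order expansion of
    [F]; the image of the remainder is absorbed because it is eventually at most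
    half of [`|x - u|]. *)
Lemma diff_expanding d m p (F : 'rV[R]_d -> 'M[R]_(m, p)) u :
  differentiable F u -> injective ('d F u) ->
  exists2 k, 0 < k & \forall x \near u, `|x - u| <= k * `|F x - F u|.
Proof.
move=> dF /linear_left_inverse[L FK].
have [k k0 Lk] := linear_lipschitz (@mx_linear_continuous _ _ _ L).
exists (2 * k); first by rewrite mulr_gt0.
have k20 : 0 < (2 * k)^-1 by rewrite invr_gt0 mulr_gt0.
have [_ /funext/eqaddoP/(_ _ k20)] := (diff_locallyxP _ _).1 dF.
rewrite [X in _ -> X](near_shift 0 u) subr0; apply: filterS => h /=.
rewrite addrK !fctE opprD addrA; set D := F (h + u) - F u => Dh.
have : `|h| <= k * `|D| + k * `|D - 'd F u h|.
  rewrite -{1}(FK h) -[X in L X](subKr D) linearB (le_trans (ler_normB _ _))//.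
  by rewrite lerD.
have : k * `|D - 'd F u h| <= 2^-1 * `|h|.
  rewrite (le_trans (ler_wpM2l (ltW k0) Dh))// invfM.
  by rewrite !mulrA [k * _]mulrC mulfK ?gt_eqF.
lra.
Qed.

Lemma diff_near_eq (V W : normedModType R) (f g : V -> W) p v :
  differentiable f p -> differentiable g p -> (\forall x \near p, f x = g x) ->
  'd f p v = 'd g p v.
Proof.
by move=> df dg fg; rewrite -!deriveE//; exact: near_eq_derive.
Qed.

Lemma diff_linear_comp (V W W' : normedModType R) (L : {linear W -> W'})
    (f : V -> W) p v : continuous L -> differentiable f p ->
  differentiable (L \o f) p /\ 'd (L \o f) p v = L ('d f p v).
Proof.
move=> cL df; have dL : differentiable L (f p) by exact: linear_differentiable.
by split; [exact: differentiable_comp|rewrite diff_comp//= diff_lin].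
Qed.

Lemma cvg_harmonic_dnbhs : (N.+1%:R^-1 : R) @[N --> \oo] --> 0^'.
Proof.
move=> A A0; have hA := @cvg_harmonic R _ (A0 : nbhs 0 _).
apply: (@filterS _ \oo _ _ _ _ hA) => N; apply.
by rewrite /harmonic /= invr_eq0 pnatr_eq0.
Qed.

Lemma diff_quotient_cvg (V W : normedModType R) (f : V -> W) u v :
  differentiable f u ->
  N%:R *: (f (N%:R^-1 *: v + u) - f u) @[N --> \oo] --> 'd f u v.
Proof.
move=> df; rewrite -deriveE; last exact: df.
rewrite -(@cvg_shiftS W).
have cv : derivable f u v by exact: diff_derivable.
have := cvg_comp _ _ cvg_harmonic_dnbhs cv; apply: cvg_trans.
apply: near_eq_cvg; apply: nearW => N /=.
by rewrite invrK.
Qed.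

Lemma closed_ball_compact d (u : 'rV[R]_d) r : 0 < r ->
  compact (closed_ball u r).
Proof.
move=> r0; apply: bounded_closed_compact; last exact: closed_ball_closed.
rewrite closed_ballE//; exists (`|u| + r); split; first exact: num_real.
move=> M ltM x /= xr; rewrite (le_trans _ (ltW ltM))//.
rewrite -(subKr u x) (le_trans (ler_normB _ _))// lerD//.
Qed.

End DifferentialCalculus.

(** * Charts of a matrix Lie group *)

Section Charts.
Variables (R : realType) (n : nat) (H : matrix_lie_group R n).
Notation atlas := (mlg_atlas (m := H)).

Lemma smooth_differentiable (V W : normedModType R) (U : set V) (f : V -> W) x :
  smooth_on U f -> U x -> differentiable f x.
Proof. by move=> /(_ 1)[+ _]; exact. Qed.

Lemma chart_open c : atlas c -> open (chart_dom c).
Proof. by move=> /mlg_immersed[]. Qed.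

Lemma chart_inj c u v : atlas c -> chart_dom c u -> chart_dom c v ->
  chart_map c u = chart_map c v -> u = v.
Proof. by move=> /mlg_immersed[_ + _ _] cu cv; apply; rewrite inE. Qed.

Lemma chart_differentiable c u :
  atlas c -> chart_dom c u -> differentiable (chart_map c) u.
Proof. by move=> /mlg_immersed[_ _ cs _]; exact: smooth_differentiable. Qed.

Lemma chart_diff_inj c u :
  atlas c -> chart_dom c u -> injective ('d (chart_map c) u).
Proof. by move=> /mlg_immersed[_ _ _]; apply. Qed.

Lemma chart_at g : mlg_set H g ->
  exists c u, [/\ atlas c, chart_dom c u & chart_map c u = g].
Proof. by rewrite mlg_cover => -[c Hc [u cu <-]]; exists c, u. Qed.

Lemma mlg_chart c u : atlas c -> chart_dom c u -> mlg_set H (chart_map c u).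
Proof. by move=> Hc cu; rewrite mlg_cover; exists c => //; exists u. Qed.

(** Products of families of group elements, parametrized by any normed space
    [V], are differentiable when read in the chart [c].  Taking one of the
    factors constant gives translations and changes of charts. *)
Lemma chart_mul (V : normedModType R) a b c (phi psi : V -> _) p r :
  atlas a -> atlas b -> atlas c ->
  differentiable phi p -> differentiable psi p ->
  chart_dom a (phi p) -> chart_dom b (psi p) -> chart_dom c r ->
  chart_map c r = chart_map a (phi p) *m chart_map b (psi p) ->
  exists z : V -> 'rV[R]_(mlg_dim H),
    [/\ differentiable z p, z p = r & \forall x \near p, chart_dom c (z x) /\
        chart_map c (z x) = chart_map a (phi x) *m chart_map b (psi x)].
Proof.
move=> Ha Hb Hc dphi dpsi ap bp cr cE.
have [Wo [f fs fW]] := mlg_smoothM Ha Hb Hc; set W := [set _ | _] in Wo fs fW.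
have Wp : W (phi p, psi p) by split => //=; exists r.
have dz : differentiable (f \o (fun x => (phi x, psi x))) p.
  apply: differentiable_comp; first exact: differentiable_pair.
  exact: smooth_differentiable fs _.
exists (f \o (fun x => (phi x, psi x))); split => //.
  have [] := fW _ Wp; move=> /= cf cfE.
  by apply: (chart_inj Hc) => //; rewrite cfE.
have : \forall x \near p, W (phi x, psi x).
  apply: (differentiable_continuous (differentiable_pair dphi dpsi)).
  exact: open_nbhs_nbhs.
by apply: filterS => x /fW.
Qed.

Lemma diff_chart_comp (V : normedModType R) c (z : V -> _) p v :
  atlas c -> chart_dom c (z p) -> differentiable z p ->
  differentiable (chart_map c \o z) p /\
  'd (chart_map c \o z) p v = 'd (chart_map c) (z p) ('d z p v).
Proof.
move=> Hc cz dz; have dc := chart_differentiable Hc cz.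
by split; [exact: differentiable_comp|rewrite diff_comp].
Qed.

(** * The Lie algebra as a closed subspace *)

(** The definition of the Lie algebra lets the chart vary with the vector;
    multiplying by the constant [1], read in [c], transports a tangent vector
    from any other chart at the identity into [c]. *)
Lemma lie_algebraE c u : atlas c -> chart_dom c u -> chart_map c u = 1%:M ->
  lie_algebra H = range ('d (chart_map c) u).
Proof.
move=> Hc cu c1; apply/seteqP; split => [X|_ [v _ <-]]; last by exists c, u, v.
move=> [a [w [v [Ha aw a1 ->]]]].
have wE : chart_map c u = chart_map a (id w) *m chart_map c (cst u w).
  by rewrite /= a1 c1 mulmx1.
have [z [dz zw zE]] := chart_mul Ha Hc Hc (@ex_diff _ _ _ _ _ id _ _)
  (@differentiable_cst _ _ _ u w) aw cu cu wE.
have cz : chart_dom c (z w) by rewrite zw.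
have [dcz dczE] := diff_chart_comp v Hc cz dz.
subst u; exists ('d z w v); [by []|].
apply: (etrans (esym dczE)); apply: diff_near_eq;
  [exact: dcz|exact: chart_differentiable|].
by apply: filterS zE => x [_ /= ->]; rewrite c1 mulmx1.
Qed.

Lemma lie_algebra_closed : closed (lie_algebra H).
Proof.
have [c [u [Hc cu c1]]] := chart_at (mlg_1 H).
by rewrite (lie_algebraE Hc cu c1); apply/closed_linear_range/chart_diff_inj.
Qed.

Lemma lie_algebra0 : lie_algebra H 0.
Proof.
have [c [u [Hc cu c1]]] := chart_at (mlg_1 H).
by rewrite (lie_algebraE Hc cu c1); exists 0 => //; rewrite linear0.
Qed.

Lemma lie_algebraD X Y :
  lie_algebra H X -> lie_algebra H Y -> lie_algebra H (X + Y).
Proof.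
have [c [u [Hc cu c1]]] := chart_at (mlg_1 H).
rewrite (lie_algebraE Hc cu c1) => -[v _ <-] [w _ <-].
by exists (v + w) => //; rewrite linearD.
Qed.

Lemma lie_algebraZ a X : lie_algebra H X -> lie_algebra H (a *: X).
Proof.
have [c [u [Hc cu c1]]] := chart_at (mlg_1 H).
rewrite (lie_algebraE Hc cu c1) => -[v _ <-].
by exists (a *: v) => //; rewrite linearZ.
Qed.

(** * Conjugation and brackets *)

(** The family [y |-> g c(y) g^-1] passes through [1] at [u] and is read in [c]
    by two applications of [chart_mul]; its differential at [u] is the
    conjugation by [g] of that of [c]. *)
Lemma lie_algebra_conj g Y : mlg_set H g -> lie_algebra H Y ->
  lie_algebra H (g *m Y *m invmx g).
Proof.
move=> Hg; have gU := mlg_unit Hg.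
have [a [p [Ha ap aE]]] := chart_at Hg.
have [b [q [Hb bq bE]]] := chart_at (mlg_V Hg).
have [c [u [Hc cu c1]]] := chart_at (mlg_1 H).
rewrite (lie_algebraE Hc cu c1) => -[v _ <-].
have did : differentiable (@id 'rV[R]_(mlg_dim H)) u by exact: ex_diff.
have h1 : chart_map a p = chart_map a (cst p u) *m chart_map c (id u).
  by rewrite /= c1 mulmx1.
have [z [dz zu zE]] :=
  chart_mul Ha Hc Ha (@differentiable_cst _ _ _ p u) did ap cu ap h1.
have az : chart_dom a (z u) by rewrite zu.
have h2 : chart_map c u = chart_map a (z u) *m chart_map b (cst q u).
  by rewrite /= zu aE bE c1 mulmxV.
have [w [dw wu wE]] :=
  chart_mul Ha Hb Hc dz (@differentiable_cst _ _ _ q u) az bq cu h2.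
have cw : chart_dom c (w u) by rewrite wu.
have [dcw dcwE] := diff_chart_comp v Hc cw dw.
pose L := [the {linear 'M[R]_n -> 'M[R]_n} of mulmxr (invmx g) \o mulmx g].
have cL : continuous L by exact: mx_linear_continuous.
have [dLc dLcE] := diff_linear_comp v cL (chart_differentiable Hc cu).
exists ('d w u v); [by []|].
rewrite wu in dcwE; apply: (etrans (esym dcwE)); apply: (etrans _ dLcE).
apply: diff_near_eq; [exact: dcw|exact: dLc|].
apply: filterS2 zE wE => x [_ zxE] [_ wxE].
by rewrite /= wxE zxE /= aE bE.
Qed.

(** Inversion is smooth in charts, hence continuous as a map into matrices. *)
Lemma chart_invmx_cvg c u : atlas c -> chart_dom c u -> chart_map c u = 1%:M ->
  invmx (chart_map c x) @[x --> u] --> (1%:M : 'M[R]_n).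
Proof.
move=> Hc cu c1.
have [Wo [f fs fW]] := mlg_smoothV Hc Hc; set W := [set _ | _] in Wo fs fW.
have Wu : W u by split => //; exists u; rewrite // c1 invmx1.
have [cfu cfE] := fW _ Wu.
have dcf : differentiable (chart_map c \o f) u.
  apply: differentiable_comp; first exact: smooth_differentiable fs _.
  exact: chart_differentiable.
have cf1 : (chart_map c \o f) u = 1%:M by rewrite /= cfE c1 invmx1.
have : (chart_map c \o f) x @[x --> u] --> (1%:M : 'M[R]_n).
  by rewrite -cf1; exact: differentiable_continuous dcf.
move=> cf; apply: (cvg_trans _ cf).
have hW : \forall x \near u, W x by exact: open_nbhs_nbhs.
apply: (@near_eq_cvg _ _ (nbhs u)).
by apply: filterS hW => x /fW[_ /= ->].
Qed.

(** Differentiating [g(h) Y g(h)^-1] at [0] without differentiating the inverse: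
    the difference quotient equals
    [(Q Y - Y Q) g(h)^-1] with [Q = (g(h) - 1)/h], where [Q] tends to [X] and
    [g(h)^-1] to [1].  It lies in the Lie algebra by [lie_algebra_conj], and so
    does its limit. *)
Lemma lie_algebra_bracket X Y :
  lie_algebra H X -> lie_algebra H Y -> lie_algebra H (lie_bracket X Y).
Proof.
have [c [u [Hc cu c1]]] := chart_at (mlg_1 H).
rewrite {1}(lie_algebraE Hc cu c1) => -[v _ <-] hY; set X' := 'd _ u v.
have dc := chart_differentiable Hc cu.
pose g (h : R) := chart_map c (h *: v + u).
have hv0 : h *: v + u @[h --> 0^'] --> u.
  rewrite -[X in _ --> X]add0r -[X in X + _](scale0r v).
  apply: cvgD; last exact: cvg_cst.
  by apply: cvgZr_tmp; apply: cvg_within_filter; exact: cvg_id.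
have cQ : h^-1 *: (g h - 1%:M) @[h --> 0^'] --> X'.
  have cv : derivable (chart_map c) u v by exact: diff_derivable.
  rewrite /derivable c1 in cv.
  rewrite /X' -deriveE; last exact: dc.
  by rewrite /derive c1; exact: cv.
have gV1 : invmx (g h) @[h --> 0^'] --> (1%:M : 'M[R]_n).
  exact: (cvg_comp _ _ hv0 (chart_invmx_cvg Hc cu c1)).
have cZ : (h^-1 *: (g h - 1%:M) *m Y - Y *m (h^-1 *: (g h - 1%:M))) *m
    invmx (g h) @[h --> 0^'] --> (X' *m Y - Y *m X') *m 1%:M.
  apply: cvg_mulmx gV1; apply: cvgB.
    by apply: cvg_mulmx => //; exact: cvg_cst.
  by apply: cvg_mulmx => //; exact: cvg_cst.
(* The factor [1%:M] is the limit of [invmx (g h)]. *)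
rewrite /lie_bracket -[X in lie_algebra _ X]mulmx1.
apply: (closed_cvg (lie_algebra H) lie_algebra_closed _ _ cZ).
have : \forall h \near 0^', chart_dom c (h *: v + u).
  by apply: hv0; apply: open_nbhs_nbhs; split => //; exact: chart_open.
apply: filterS => h ch.
have gU : g h \in unitmx by exact/mlg_unit/mlg_chart.
rewrite -[X in lie_algebra _ X](_ :
    h^-1 *: (g h *m Y *m invmx (g h) - Y) = _); last first.
  rewrite -scalemxAl -scalemxAr -scalerBr -scalemxAl; congr (_ *: _).
  rewrite [(_ - 1%:M) *m _]mulmxBl [_ *m (_ - 1%:M)]mulmxBr mul1mx mulmx1.
  rewrite opprB addrA subrK mulmxBl.
  by rewrite mulmxK.
apply: lie_algebraZ; apply: lie_algebraD.
  exact/lie_algebra_conj/hY/mlg_chart.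
by rewrite -scaleN1r; exact: lie_algebraZ.
Qed.

(** * The exponential of the Lie algebra *)

(** Smallness of the velocity [X] is measured by [expR (n%:R * `|X|)] because,
    for large [N], the powers [c(u + v/N)^j] with [j <= N] are all at distance
    from [1] at most about [expR (n%:R * `|X|) - 1].  Their coordinates are
    built one factor at a time: the coordinate [f] of the product is continuous,
    so one more factor does not leave the ball of radius [r] where [c] expands
    distances, and this expansion then brings the new coordinate back into the
    ball of radius [d]. *)
Lemma expmx_small c u : atlas c -> chart_dom c u -> chart_map c u = 1%:M ->
  exists2 e, 1 < e & forall v, expR (n%:R * `|'d (chart_map c) u v|) < e ->
    mlg_set H (expmx ('d (chart_map c) u v)).
Proof.
move=> Hc cu c1; have dc := chart_differentiable Hc cu.
have [k k0 kE] := diff_expanding dc (chart_diff_inj Hc cu).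
have [Wo [f fs fW]] := mlg_smoothM Hc Hc Hc; set W := [set _ | _] in Wo fs fW.
have Wuu : W (u, u) by split => //=; exists u; rewrite // c1 mulmx1.
have fuu : f (u, u) = u.
  have [cf cfE] := fW _ Wuu.
  by apply: (chart_inj Hc) => //; rewrite cfE /= c1 mulmx1.
have : \forall x \near u,
    chart_dom c x /\ `|x - u| <= k * `|chart_map c x - 1%:M|.
  rewrite -c1; apply: filterI => //.
  by apply: open_nbhs_nbhs; split => //; exact: chart_open.
move=> /nbhs_ballP[r /= r0 rP].
have : \forall p \near (u, u), W p /\ ball u r (f p).
  apply: filterI; first exact: open_nbhs_nbhs.
  have fu : f p @[p --> (u, u)] --> u.
    rewrite -[X in _ --> X]fuu.
    exact: differentiable_continuous (smooth_differentiable fs Wuu).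
  by apply: fu; exact: nbhsx_ballx.
move=> /nbhs_ballP[d0 /= d00 d0P].
pose d := Num.min d0 (r / 2).
have d_gt0 : 0 < d by rewrite lt_min d00 divr_gt0.
have dr : d < r by rewrite gt_min; apply/orP; right; lra.
have dd0 : d <= d0 by rewrite ge_min lexx.
exists (1 + d / k); first by rewrite ltrDl divr_gt0.
move=> v vsmall; set X := 'd _ u v in vsmall *.
pose y N := N%:R^-1 *: v + u.
pose Y N := N%:R *: (chart_map c (y N) - 1%:M).
have YX : Y N @[N --> \oo] --> X.
  by rewrite /Y -c1; exact: diff_quotient_cvg.
have yu : y N @[N --> \oo] --> u.
  rewrite -[X in _ --> X]add0r -[X in X + _](scale0r v).
  apply: cvgD; last exact: cvg_cst.
  by apply: cvgZr_tmp; exact: cvg_inv_nat.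
have Ysmall : \forall N \near \oo, expR (n%:R * `|Y N|) < 1 + d / k.
  have : expR (n%:R * `|Y N|) @[N --> \oo] --> expR (n%:R * `|X|).
    apply: continuous_cvg; first exact: continuous_expR.
    by apply: cvgMr; exact: cvg_norm.
  by move=> /cvgr_lt; apply.
have step N : (0 < N)%N -> ball u d (y N) -> expR (n%:R * `|Y N|) < 1 + d / k ->
    forall j, (j <= N)%N -> exists2 x, ball u d x &
      chart_map c x = (1 + N%:R^-1 *: Y N) ^+ j.
  move=> N0 yd Ys; have N0' : N%:R != 0 :> R by rewrite pnatr_eq0 -lt0n.
  have AE : 1 + N%:R^-1 *: Y N = chart_map c (y N).
    by rewrite /Y scalerA mulVf// scale1r addrC subrK.
  elim => [_|j IH jN]; first by exists u; [exact: ballxx|rewrite expr0].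
  have [x xd xE] := IH (ltnW jN).
  have [Wxy rxy] : W (x, y N) /\ ball u r (f (x, y N)).
    by apply: d0P; split => /=; exact: le_ball dd0 _ _.
  have [_ fE] := fW _ Wxy; rewrite /= xE -AE mulmxE -exprSr in fE.
  exists (f (x, y N)) => //.
  (* The new coordinate is only known to be in the ball of radius [r]; the
     distance of the power to [1] controls it better. *)
  have [_] := rP _ rxy; rewrite fE => fle.
  rewrite -ball_normE /ball_ /= distrC (le_lt_trans fle)//.
  rewrite mulrC -ltr_pdivlMr//.
  rewrite (le_lt_trans (mx_norm_exp1DB1 _ _))// ltrBlDl (le_lt_trans _ Ys)//.
  rewrite normrZ ger0_norm ?invr_ge0// mulrCA.
  rewrite (le_trans _ (compound_le_expR N _)) ?mulr_ge0//.
  by rewrite ler_weXn2l// lerDl !mulr_ge0// invr_ge0.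
(* Compactness of [S] is what keeps the limit inside [H]. *)
pose S := chart_map c @` closed_ball u d.
have dom_ball : closed_ball u d `<=` chart_dom c.
  by move=> x xd; have [] := rP x (closed_ball_subset d_gt0 dr xd).
have Scl : closed S.
  apply: compact_closed; first exact: norm_hausdorff.
  apply: continuous_compact; last exact: closed_ball_compact.
  apply: continuous_in_subspaceT => x; rewrite inE => /dom_ball cx.
  exact/differentiable_continuous/chart_differentiable.
suff [x xd <-] : S (expmx X) by exact/mlg_chart/dom_ball.
apply: (closed_cvg S Scl _ _ (cvg_compound_expmx_seq YX)).
have yd : \forall N \near \oo, ball u d (y N).
  by apply: yu; exact: nbhsx_ballx.
apply: filterS3 (nbhs_infty_gt 0) yd Ysmall => N N0 yNd YNs.
have [x xd xE] := step N N0 yNd YNs N (leqnn N).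
by exists x => //; exact: subset_closed_ball.
Qed.

Lemma expmx_lie_algebra X : lie_algebra H X -> mlg_set H (expmx X).
Proof.
have [c [u [Hc cu c1]]] := chart_at (mlg_1 H).
have [e e1 small] := expmx_small Hc cu c1.
move=> hX; pose x := n%:R * `|X|.
have cx : expR (M%:R^-1 * x) @[M --> \oo] --> (1 : R).
  rewrite -[X in _ --> X]expR0; apply: continuous_cvg.
    exact: continuous_expR.
  by rewrite -[X in _ --> X](mul0r x); apply: cvgMl; exact: cvg_inv_nat.
have [M [M0 Me]] : exists M, (0 < M)%N /\ expR (M%:R^-1 * x) < e.
  have hM : \forall M \near \oo, expR (M%:R^-1 * x) < e.
    by move: cx => /cvgr_lt; apply.
  by have [M []] := filter_ex (filterI (nbhs_infty_gt 0) hM); exists M.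
rewrite (expmx_natV _ M0).
have : lie_algebra H (M%:R^-1 *: X) by exact: lie_algebraZ.
rewrite {1}(lie_algebraE Hc cu c1) => -[v _ vE].
have : mlg_set H (expmx (M%:R^-1 *: X)).
  rewrite -vE; apply: small; rewrite vE normrZ ger0_norm ?invr_ge0//.
  by rewrite mulrCA.
elim: M {M0 Me vE} (expmx _) => [|M IH] g Hg; first exact: mlg_1.
by rewrite exprS; apply: mlg_M => //; exact: IH.
Qed.

End Charts.

(** * Update steps *)

Section SampleCombinations.
Variables (R : realType) (n s : nat) (H : matrix_lie_group R n).
Variable V : 'I_s -> 'M[R]_n.

Lemma lie_algebra_sum I (r : seq I) (P : pred I) (F : I -> 'M[R]_n) :
  (forall i, P i -> lie_algebra H (F i)) ->
  lie_algebra H (\sum_(i <- r | P i) F i).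
Proof.
move=> hF; elim/big_ind: _ => //; first exact: lie_algebra0.
by move=> X Y; exact: lie_algebraD.
Qed.

Lemma nested_bracket_lie_algebra B :
  (forall j, lie_algebra H (V j)) -> nested_bracket V B -> lie_algebra H B.
Proof. by move=> hV; elim => // X Y _ hX _ hY; exact: lie_algebra_bracket. Qed.

(** Closedness is what handles infinite combinations. *)
Lemma sample_combination_lie_algebra Phi :
  (forall j, lie_algebra H (V j)) ->
  sample_combination V Phi -> lie_algebra H Phi.
Proof.
move=> hV; have term a B : nested_bracket V B -> lie_algebra H (a *: B).
  by move=> hB; apply: lie_algebraZ; exact: nested_bracket_lie_algebra.
case=> [[m [a [B [hB ->]]]]|[a [B [hB cB]]]].
  by apply: lie_algebra_sum => k _; exact: term.
apply: (closed_cvg (lie_algebra H) (@lie_algebra_closed _ _ H) _ _ cB).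
by apply: nearW => N; apply: lie_algebra_sum => k _; exact: term.
Qed.

End SampleCombinations.

Theorem corollary1 (R : realType) (n : nat) (G H : matrix_lie_group R n)
  (hHG : lie_subgroup H G)
  (constraints : 'M[R]_n -> Prop)
  (hconstraints : forall g, mlg_set G g -> (constraints g <-> mlg_set H g))
  (s : nat) (V : 'I_s -> 'M[R]_n)
  (hV : forall j, lie_algebra H (V j))
  (g1 : 'M[R]_n)
  (hstep :
    (exists g0, [/\ mlg_set G g0, constraints g0 & group_step V g0 g1]) \/
    (exists q0, lie_algebra H q0 /\ coordinate_step V q0 g1)) :
  constraints g1 /\ mlg_set H g1.
Proof.
suff Hg1 : mlg_set H g1 by split => //; apply/hconstraints => //; exact: hHG.1.
case: hstep => [[g0 [Gg0 Cg0 [Phi hPhi ->]]]|[q0 [hq0 [Phi hPhi ->]]]].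
  apply: mlg_M; first exact/hconstraints.
  exact/expmx_lie_algebra/(sample_combination_lie_algebra hV).
apply: expmx_lie_algebra; apply: lie_algebraD => //.
exact: (sample_combination_lie_algebra hV).
Qed.
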